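(* For each finite set $I$ let $\mathrm{GP}[I]$ be the set of bounded generalized permutahedra in $\mathbb R I$. For each decomposition $I=S\sqcup T$ define the product of $\mathfrak p\in\mathrm{GP}[S]$ and $\mathfrak q\in\mathrm{GP}[T]$ to be $\mathfrak p\cdot\mathfrak q:=\mathfrak p\times\mathfrak q\in\mathrm{GP}[I]$, and the coproduct of $\mathfrak p\in\mathrm{GP}[I]$ to be $\Delta_{S,T}(\mathfrak p)=(\mathfrak p|_S,\mathfrak p/_S)\in \mathrm{GP}[S]\times\mathrm{GP}[T]$, where $\mathfrak p|_S$ and $\mathfrak p/_S$ are the restriction and contraction of $\mathfrak p$ with respect to $S$. These operations turn the set species $\mathrm{GP}$ into a (connected) Hopf monoid in set species.
   Context: For a finite set $I$, $\mathbb R I$ is the real vector space with basis $\{e_i\}_{i\in I}$, and $\mathbb R^I$ is its dual. For a polytope $\mathfrak p\subseteq\mathbb R I$ and $y\in\mathbb R^I$, $\mathfrak p_y$ is the face of $\mathfrak p$ maximizing $y$. The braid arrangement in $\mathbb R^I$ is the set of hyperplanes $y(i)=y(j)$, $i\neq j$. A generalized permutahedron in $\mathbb R I$ is a nonempty polytope whose normal fan is a coarsening of the fan of faces of the braid arrangement. A bijection $\sigma:I\to J$ acts by $e_i\mapsto e_{\sigma(i)}$. Restriction and contraction: for $I=S\sqcup T$ and a generalized permutahedron $\mathfrak p\subseteq\mathbb RI$, the face of $\mathfrak p$ maximizing $\mathbf 1_S(x)=\sum_{s\in S}x_s$ factors as $\mathfrak p|_S\times\mathfrak p/_S$ with $\mathfrak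 p|_S\subseteq\mathbb RS$ and $\mathfrak p/_S\subseteq\mathbb RT$ generalized permutahedra (under $\mathbb RI=\mathbb RS\times\mathbb RT$); these are the restriction and contraction. A set species $\mathrm H$ assigns to each finite set $I$ a set $\mathrm H[I]$ and to each bijection $\sigma:I\to J$ a map $\mathrm H[\sigma]:\mathrm H[I]\to \mathrm H[J]$, functorially. A connected Hopf monoid in set species is a set species with $\mathrm H[\emptyset]=\{1\}$ a singleton, together with, for each finite set $I$ and each ordered decomposition $I=S\sqcup T$ (parts may be empty), maps $(x,y)\mapsto x\cdot y$ from $\mathrm H[S]\times \mathrm H[T]$ to $\mathrm H[I]$ and $z\mapsto(z|_S,z/_S)$ from $\mathrm H[I]$ to $\mathrm H[S]\times \mathrm H[T]$ such that: (Naturality) for each bijection $\sigma:I\to J$: $\mathrm H[\sigma](x\cdot y)=\mathrm H[\sigma|_S](x)\cdot \mathrm H[\sigma|_T](y)$, $\mathrm H[\sigma](z)|_{\sigma(S)}=\mathrm H[\sigma|_S](z|_S)$, $\mathrm H[\sigma](z)/_{\sigma(S)}=\mathrm H[\sigma|_T](z/_S)$. (Unitality) $x\cdot1=x=1\cdot x$ and $x|_I=x=x/_\emptyset$. (Associativity) for $I=R\sqcup S\sqcup T$: $x\cdot(y\cdot z)=(x\cdot y)\cdot z$, $(w|_{R\sqcup S})|_R=w|_R$, $(w|_{R\sqcup S})/_R=(w/_R)|_S$, $w/_{R\sqcup S}=(w/_R)/_S$. (Compatibility) for $S\sqcup T=I=S'\sqcup T'$ with $A=S\cap S'$, $B=S\cap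 T'$, $C=T\cap S'$, $D=T\cap T'$, and $x\in \mathrm H[S]$, $y\in \mathrm H[T]$: $(x\cdot y)|_{S'}=x|_A\cdot y|_C$ and $(x\cdot y)/_{S'}=x/_A\cdot y/_C$. *)

(* Defs.v *)
From mathcomp Require Import all_boot all_order all_algebra finmap.
From mathcomp Require Import boolp classical_sets reals.

Set Implicit Arguments.
Unset Strict Implicit.
Unset Printing Implicit Defensive.

Import Order.TTheory GRing.Theory Num.Theory.
Local Open Scope classical_set_scope.
Local Open Scope ring_scope.

(* A finite set is a finite subset [I : {fset K}] of an arbitrary choiceType
   [K]; bijections may relate finite subsets of different ambient types, while
   the parts of a decomposition of [I] live in the same ambient type as [I].
   Since a decomposition is a relation between sets, no transport is needed to
   state associativity and compatibility. *)
Definition decomp (K : choiceType) (I S T : {fset K}) : bool :=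
  (I == S `|` T)%fset && [disjoint S & T]%fset.

Lemma decomp_subl (K : choiceType) (I S T : {fset K}) :
  decomp I S T -> (S `<=` I)%fset.
Proof. by case/andP => /eqP -> _; exact: fsubsetUl. Qed.

Lemma decomp_subr (K : choiceType) (I S T : {fset K}) :
  decomp I S T -> (T `<=` I)%fset.
Proof. by case/andP => /eqP -> _; exact: fsubsetUr. Qed.

(* For subsets S of I and S' of J, and s a bijection from I onto J, a bijection
   t from S onto S' with [restricts s t] exists iff S' = s(S), and then t is the
   restriction of s to S. *)
Definition restricts (K L : choiceType) (I S : {fset K}) (J S' : {fset L})
    (s : I -> J) (t : S -> S') : Prop :=
  forall (i : I) (a : S), val i = val a -> val (s i) = val (t a).

Record set_species (H : forall K : choiceType, {fset K} -> Type) : Type :=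
  SetSpecies {
  sp_map : forall (K L : choiceType) (I : {fset K}) (J : {fset L})
    (s : I -> J), bijective s -> H K I -> H L J ;
  sp_map_id : forall (K : choiceType) (I : {fset K})
    (hid : bijective (fun i : I => i)) (x : H K I), sp_map hid x = x ;
  sp_map_comp : forall (K L M : choiceType) (I : {fset K}) (J : {fset L})
    (N : {fset M}) (s : I -> J) (t : J -> N) (hs : bijective s)
    (ht : bijective t) (hts : bijective (fun i => t (s i))) (x : H K I),
    sp_map hts x = sp_map ht (sp_map hs x)
}.

(* For d : decomp I S T, [hm_res d z] is z|_S and [hm_con d z] is z/_S. *)
Record connected_hopf_monoid (H : forall K : choiceType, {fset K} -> Type)
    (M : set_species H) : Type := ConnectedHopfMonoid {
  hm_one : forall K : choiceType, H K fset0 ;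
  hm_mul : forall (K : choiceType) (I S T : {fset K}),
    decomp I S T -> H K S -> H K T -> H K I ;
  hm_res : forall (K : choiceType) (I S T : {fset K}),
    decomp I S T -> H K I -> H K S ;
  hm_con : forall (K : choiceType) (I S T : {fset K}),
    decomp I S T -> H K I -> H K T ;

  hm_connected : forall (K : choiceType) (x : H K fset0), x = hm_one K ;

  hm_mul_nat : forall (K L : choiceType) (I S T : {fset K})
    (J S' T' : {fset L}) (d : decomp I S T) (d' : decomp J S' T')
    (s : I -> J) (sS : S -> S') (sT : T -> T')
    (hs : bijective s) (hS : bijective sS) (hT : bijective sT),
    restricts s sS -> restricts s sT ->
    forall (x : H K S) (y : H K T),
    sp_map M hs (hm_mul d x y) = hm_mul d' (sp_map M hS x) (sp_map M hT y) ;
  hm_res_nat : forall (K L : choiceType) (I S T : {fset K})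
    (J S' T' : {fset L}) (d : decomp I S T) (d' : decomp J S' T')
    (s : I -> J) (sS : S -> S') (sT : T -> T')
    (hs : bijective s) (hS : bijective sS) (hT : bijective sT),
    restricts s sS -> restricts s sT ->
    forall z : H K I,
    hm_res d' (sp_map M hs z) = sp_map M hS (hm_res d z) ;
  hm_con_nat : forall (K L : choiceType) (I S T : {fset K})
    (J S' T' : {fset L}) (d : decomp I S T) (d' : decomp J S' T')
    (s : I -> J) (sS : S -> S') (sT : T -> T')
    (hs : bijective s) (hS : bijective sS) (hT : bijective sT),
    restricts s sS -> restricts s sT ->
    forall z : H K I,
    hm_con d' (sp_map M hs z) = sp_map M hT (hm_con d z) ;

  hm_mul1 : forall (K : choiceType) (I : {fset K}) (d : decomp I I fset0)
    (x : H K I), hm_mul d x (hm_one K) = x ;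
  hm_1mul : forall (K : choiceType) (I : {fset K}) (d : decomp I fset0 I)
    (x : H K I), hm_mul d (hm_one K) x = x ;
  hm_res_all : forall (K : choiceType) (I : {fset K}) (d : decomp I I fset0)
    (x : H K I), hm_res d x = x ;
  hm_con_none : forall (K : choiceType) (I : {fset K}) (d : decomp I fset0 I)
    (x : H K I), hm_con d x = x ;

  (* Here RS and ST are the disjoint unions of R and S, and of S and T. *)
  hm_mulA : forall (K : choiceType) (I R S T RS ST : {fset K})
    (d1 : decomp I RS T) (d2 : decomp RS R S)
    (d3 : decomp I R ST) (d4 : decomp ST S T)
    (x : H K R) (y : H K S) (z : H K T),
    hm_mul d3 x (hm_mul d4 y z) = hm_mul d1 (hm_mul d2 x y) z ;
  hm_res_res : forall (K : choiceType) (I R S T RS ST : {fset K})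
    (d1 : decomp I RS T) (d2 : decomp RS R S)
    (d3 : decomp I R ST) (d4 : decomp ST S T) (w : H K I),
    hm_res d2 (hm_res d1 w) = hm_res d3 w ;
  hm_con_res : forall (K : choiceType) (I R S T RS ST : {fset K})
    (d1 : decomp I RS T) (d2 : decomp RS R S)
    (d3 : decomp I R ST) (d4 : decomp ST S T) (w : H K I),
    hm_con d2 (hm_res d1 w) = hm_res d4 (hm_con d3 w) ;
  hm_con_con : forall (K : choiceType) (I R S T RS ST : {fset K})
    (d1 : decomp I RS T) (d2 : decomp RS R S)
    (d3 : decomp I R ST) (d4 : decomp ST S T) (w : H K I),
    hm_con d1 w = hm_con d4 (hm_con d3 w) ;

  (* The last four decompositions always hold, given the first two; naming
     their proofs is only needed to apply the operations. *)
  hm_compat_res : forall (K : choiceType) (I S T S' T' : {fset K})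
    (d : decomp I S T) (d' : decomp I S' T')
    (dS : decomp S (S `&` S')%fset (S `&` T')%fset)
    (dT : decomp T (T `&` S')%fset (T `&` T')%fset)
    (dS' : decomp S' (S `&` S')%fset (T `&` S')%fset)
    (dT' : decomp T' (S `&` T')%fset (T `&` T')%fset)
    (x : H K S) (y : H K T),
    hm_res d' (hm_mul d x y) = hm_mul dS' (hm_res dS x) (hm_res dT y) ;
  hm_compat_con : forall (K : choiceType) (I S T S' T' : {fset K})
    (d : decomp I S T) (d' : decomp I S' T')
    (dS : decomp S (S `&` S')%fset (S `&` T')%fset)
    (dT : decomp T (T `&` S')%fset (T `&` T')%fset)
    (dS' : decomp S' (S `&` S')%fset (T `&` S')%fset)
    (dT' : decomp T' (S `&` T')%fset (T `&` T')%fset)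
    (x : H K S) (y : H K T),
    hm_con d' (hm_mul d x y) = hm_mul dT' (hm_con dS x) (hm_con dT y)
}.

Section Polytopes.
Variable R : realType.

Section FixedIndexSet.
Variables (K : choiceType) (I : {fset K}).

(* Points x of RI are given by coordinates x = \sum_i x(i) e_i, and functionals
   y in the dual R^I by their values y(i) = y(e_i). *)
Definition vecspace : Type := {ffun I -> R}.
Definition dualspace : Type := {ffun I -> R}.

Definition pairing (y : dualspace) (x : vecspace) : R := \sum_(i : I) y i * x i.

Definition conv_hull (n : nat) (v : 'I_n -> vecspace) : set vecspace :=
  [set x | exists w : 'I_n -> R,
     [/\ forall k, 0 <= w k, \sum_(k < n) w k = 1
       & x = [ffun i => \sum_(k < n) w k * v k i]]].

Definition is_polytope (p : set vecspace) : Prop :=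
  exists (n : nat) (v : 'I_n -> vecspace), p = conv_hull v.

Definition max_face (p : set vecspace) (y : dualspace) : set vecspace :=
  [set x | p x /\ forall z, p z -> pairing y z <= pairing y x].

(* The nonempty faces of a nonempty polytope. *)
Definition faces (p : set vecspace) : set (set vecspace) :=
  [set q | exists y, q = max_face p y].

Definition normal_cone (p q : set vecspace) : set dualspace :=
  [set y | q `<=` max_face p y].

Definition normal_fan (p : set vecspace) : set (set dualspace) :=
  [set N | exists2 q, faces p q & N = normal_cone p q].

(* The closed face of the braid arrangement whose relative interior contains
   y0: the functionals lying, for each hyperplane y(i) = y(j), on the hyperplane
   if y0 does, and weakly on the same side as y0 otherwise. *)
Definition braid_face (y0 : dualspace) : set dualspace :=
  [set y | forall i j : I, (y0 i = y0 j -> y i = y j) /\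
                           (y0 i < y0 j -> y i <= y j)].

Definition braid_fan : set (set dualspace) :=
  [set C | exists y0, C = braid_face y0].

(* For fans with the same support; normal fans of nonempty polytopes and the
   braid fan all have the whole of R^I as support. *)
Definition coarsening (G F : set (set dualspace)) : Prop :=
  forall C, F C -> exists2 D, G D & C `<=` D.

Definition is_gen_permutahedron (p : set vecspace) : Prop :=
  [/\ is_polytope p, p !=set0 & coarsening (normal_fan p) braid_fan].

End FixedIndexSet.

Definition GP (K : choiceType) (I : {fset K}) : Type :=
  {p : set (vecspace I) | is_gen_permutahedron p}.

(* The linear map sending e_i to e_(s i). *)
Definition relabel (K L : choiceType) (I : {fset K}) (J : {fset L})
    (s : I -> J) (x : vecspace I) : vecspace J :=
  [ffun j => \sum_(i : I | s i == j) x i].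

Definition vproj (K : choiceType) (I S : {fset K}) (h : (S `<=` I)%fset)
    (x : vecspace I) : vecspace S :=
  [ffun a => x (fincl h a)].

(* The product of p and q inside RI, identified with RS x RT. *)
Definition poly_prod (K : choiceType) (I S T : {fset K}) (d : decomp I S T)
    (p : set (vecspace S)) (q : set (vecspace T)) : set (vecspace I) :=
  [set x | p (vproj (decomp_subl d) x) /\ q (vproj (decomp_subr d) x)].

Definition indicator (K : choiceType) (I S : {fset K}) : dualspace I :=
  [ffun i => (val i \in S)%:R].

End Polytopes.

(* Main.v *)
Require Import Defs.
From mathcomp Require Import all_boot all_order all_algebra finmap.
From mathcomp Require Import boolp classical_sets reals.
From mathcomp Require Import ring lra.

(** The normal-fan condition says that maximal faces can only grow under
    specialization: if y lies in the closed braid face spanned by y0, then every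
    maximizer of y0 also maximizes y ([gen_permutahedron_max_face]).  To prove
    that a polytope is a generalized permutahedron it is enough to find, for
    each y0, one common maximizer of the whole closed braid face of y0
    ([gen_permutahedron_of_common_max]).

    The heart of the matter is that the face F of p maximizing the indicator 1_S
    is a product.  Let y' be a specialization of a functional y inside S and inside
    T separately.  For a large M, and then for M' large depending on y', both 1_S
    and M' 1_S + y' lie in the closed braid face of M 1_S + y, since the large
    constants settle all comparisons between S and T.  Hence some
    point of F maximizes over F all such y' at once ([blockwise_common_max]);
    taking for y' the S-part and the T-part of y, it maximizes both parts.  So no functional y can separate from F a
    point x whose two projections lie in the projections of F, and x belongs to
    F by convex separation ([indicator_face_prod]).  The same blockwise common
    maximizers show that the two factors are generalized permutahedra.

    A product of nonempty sets determines its factors, so restriction and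
    contraction are the only pair of generalized permutahedra whose product is F
    ([GP_coproduct_unique]).  Every axiom about the coproduct thus follows from
    an identity between faces: naturality because relabelling commutes with
    maximal faces, coassociativity because the 1_A-face of the 1_AB-face equals
    the 1_AB-face of the 1_A-face, and compatibility because maximal faces of
    products are products of maximal faces. *)

Set Implicit Arguments.
Unset Strict Implicit.
Unset Printing Implicit Defensive.

Import Order.TTheory GRing.Theory Num.Theory.
Local Open Scope classical_set_scope.
Local Open Scope ring_scope.

(** * Separation of a point from a finitely generated convex set *)

Section Separation.
Variables (F : realFieldType) (A : finType).
Implicit Types x y z : {ffun A -> F^o}.

Definition dot y x : F := \sum_i y i * x i.

Lemma dotDr y x z : dot y (x + z) = dot y x + dot y z.
Proof. by rewrite -big_split; apply: eq_bigr => i _; rewrite ffunE mulrDr. Qed.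

Lemma dotZr y c x : dot y (c *: x) = c * dot y x.
Proof. by rewrite mulr_sumr; apply: eq_bigr => i _; rewrite ffunE mulrCA. Qed.

Lemma dotC y x : dot y x = dot x y.
Proof. by apply: eq_bigr => i _; rewrite mulrC. Qed.

Lemma dotDl y z x : dot (y + z) x = dot y x + dot z x.
Proof. by rewrite !(dotC _ x) dotDr. Qed.

Lemma dotZl y c x : dot (c *: y) x = c * dot y x.
Proof. by rewrite !(dotC _ x) dotZr. Qed.

Lemma dot_gt0 x : x != 0 -> 0 < dot x x.
Proof.
move=> x0; rewrite lt_def sumr_ge0 ?andbT => [|i _]; last exact: sqr_ge0.
apply: contra_neq x0 => /psumr_eq0P s; apply/ffunP => i; rewrite ffunE.
by apply/eqP; rewrite -sqrf_eq0 expr2 s // => j _; exact: sqr_ge0.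
Qed.

(** Farkas' lemma.  Induction on the number of generators: if a functional y that
    separates b from the cone of the other generators is positive on the first
    generator c, everything is projected along c onto the kernel of y.  A
    functional separating the projections is then corrected by a multiple of y
    so as to vanish on c. *)
Lemma farkas n (a : 'I_n -> {ffun A -> F^o}) (b : {ffun A -> F^o}) :
  (exists2 w : 'I_n -> F, forall k, 0 <= w k & b = \sum_k w k *: a k) \/
  (exists2 y, forall k, dot y (a k) <= 0 & 0 < dot y b).
Proof.
elim: n a b => [|n IH] a b.
  have [->|b0] := eqVneq b 0; last by right; exists b => [[]|] //; exact: dot_gt0.
  by left; exists (fun=> 0) => //; rewrite big_ord0.
set c := a ord0; pose a1 k := a (lift ord0 k).
have all_le y : dot y c <= 0 -> (forall k, dot y (a1 k) <= 0) ->
    forall k, dot y (a k) <= 0.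
  by move=> h0 h k; case: (unliftP ord0 k) => [j|] ->; [exact: h|exact: h0].
have [[w w0 wb]|[y ya yb]] := IH a1 b.
  left; exists (fun k => oapp w 0 (unlift ord0 k)) => [k|].
    by case: unlift => //=.
  rewrite big_ord_recl unlift_none /= scale0r add0r wb.
  by apply: eq_bigr => k _; rewrite liftK.
have [yc|yc] := leP (dot y c) 0; first by right; exists y => //; exact: all_le.
pose p x := x + (- (dot y x / dot y c)) *: c.
have yc0 : dot y c != 0 by rewrite gt_eqF.
have [[w w0 wb]|[z za zb]] := IH (p \o a1) (p b).
  left; exists (fun k => oapp w (dot y b / dot y c -
      \sum_j w j * (dot y (a1 j) / dot y c)) (unlift ord0 k)) => [k|].
    case: unlift => //=; rewrite subr_ge0 (@le_trans _ _ 0) //.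
      apply: sumr_le0 => j _; rewrite mulr_ge0_le0 // mulr_le0_ge0 //.
      by rewrite invr_ge0 ltW.
    by rewrite divr_ge0 // ltW.
  rewrite big_ord_recl unlift_none /= -/c.
  under [X in _ + X]eq_bigr do rewrite liftK /= -/(a1 _).
  move: wb; rewrite /p /=; under [in RHS]eq_bigr do rewrite scalerDr scalerA mulrN.
  rewrite big_split /= -scaler_suml sumrN !scaleNr => wb.
  by rewrite scalerBl -addrA [- _ + _]addrC -wb addrC subrK.
right; exists (z + (- (dot z c / dot y c)) *: y).
  apply: all_le => [|k]; rewrite dotDl dotZl.
    by rewrite mulNr divfK // subrr.
  apply: le_trans (za k); rewrite dotDr dotZr le_eqVlt; apply/orP; left; apply/eqP.
  by field.
rewrite dotDl dotZl; apply: lt_le_trans zb _.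
rewrite dotDr dotZr le_eqVlt; apply/orP; left; apply/eqP; by field.
Qed.
End Separation.

(** Homogenization: x is a convex combination of the v k exactly when (x, 1) is in
    the cone spanned by the (v k, 1). *)
Lemma convex_separation (F : realFieldType) (A : finType) n
    (v : 'I_n -> {ffun A -> F}) (x : {ffun A -> F}) :
  (exists w : 'I_n -> F, [/\ forall k, 0 <= w k, \sum_k w k = 1
     & x = [ffun i => \sum_k w k * v k i]]) \/
  (exists y : {ffun A -> F}, forall k, dot y (v k) < dot y x).
Proof.
pose homog (u : {ffun A -> F}) : {ffun A + unit -> F^o} :=
  [ffun o => if o is inl i then u i else 1 : F^o].
pose restr (u : {ffun A + unit -> F^o}) : {ffun A -> F} := [ffun i => u (inl i)].
have dot_homog u z : dot u (homog z) = dot (restr u) z + u (inr tt).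
  rewrite /dot big_sumType /=; congr +%R.
    by apply: eq_bigr => i _; rewrite !ffunE.
  by rewrite (big_pred1 tt) => [|[]] //; rewrite ffunE mulr1.
have [[w w0 wx]|[y yv yx]] := farkas (homog \o v) (homog x); [left|right].
  have wxE o : homog x o = \sum_k w k * homog (v k) o.
    by rewrite wx sum_ffunE; apply: eq_bigr => k _; rewrite ffunE.
  exists w; split => //.
    have := wxE (inr tt); rewrite ffunE => ->.
    by apply: eq_bigr => k _; rewrite ffunE mulr1.
  apply/ffunP => i; have := wxE (inl i); rewrite !ffunE => ->.
  by apply: eq_bigr => k _; rewrite ffunE.
exists (restr y) => k.
rewrite -(ltrD2r (y (inr tt))) -!dot_homog; exact: le_lt_trans (yv k) yx.
Qed.

(** * Polytopes and their maximal faces *)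

Section Polytopes.
Variables (R : realType) (K : choiceType) (I : {fset K}).
Implicit Types (p : set (vecspace R I)) (y : dualspace R I) (x : vecspace R I).

Lemma pairing_comb n (w : 'I_n -> R) (v : 'I_n -> vecspace R I) y :
  pairing y [ffun i => \sum_k w k * v k i] = \sum_k w k * pairing y (v k).
Proof.
rewrite /pairing; under eq_bigr do rewrite ffunE mulr_sumr.
rewrite exchange_big; apply: eq_bigr => k _; rewrite mulr_sumr.
by apply: eq_bigr => i _; rewrite mulrCA.
Qed.

Lemma pairing_lin c e y y' x :
  pairing [ffun i => c * y i + e * y' i] x = c * pairing y x + e * pairing y' x.
Proof.
rewrite /pairing !mulr_sumr -big_split; apply: eq_bigr => i _.
by rewrite ffunE mulrDl !mulrA.
Qed.

Lemma max_face_pairing p y x x' :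
  max_face p y x -> max_face p y x' -> pairing y x = pairing y x'.
Proof. by move=> [px xM] [px' x'M]; apply/le_anti; rewrite xM // x'M. Qed.

Lemma vertex_in_conv_hull n (v : 'I_n -> vecspace R I) k : conv_hull v (v k).
Proof.
exists (fun j => (j == k)%:R); split => [j||]; first exact: ler0n.
  by rewrite (bigD1 k) //= eqxx big1 ?addr0 // => j /negbTE ->.
apply/ffunP => i; rewrite ffunE (bigD1 k) //= eqxx mul1r big1 ?addr0 //.
by move=> j /negbTE ->; rewrite mul0r.
Qed.

Lemma conv_hull_subset n n' (v : 'I_n -> vecspace R I) (u : 'I_n' -> vecspace R I) :
  (forall l, conv_hull v (u l)) -> conv_hull u `<=` conv_hull v.
Proof.
move=> /choice[W uW] x [w [w0 w1 ->]].
exists (fun k => \sum_l w l * W l k); split.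
- by move=> k; apply: sumr_ge0 => l _; rewrite mulr_ge0 //; case: (uW l).
- rewrite exchange_big -[RHS]w1; apply: eq_bigr => l _.
  by rewrite -mulr_sumr; case: (uW l) => _ -> _; rewrite mulr1.
apply/ffunP => i; rewrite !ffunE; under [RHS]eq_bigr do rewrite mulr_suml.
rewrite exchange_big; apply: eq_bigr => l _; case: (uW l) => _ _ ->.
by rewrite ffunE mulr_sumr; apply: eq_bigr => k _; rewrite mulrA.
Qed.

(** A weighted mean of the values at the generators is at most the largest one. *)
Lemma conv_hull_le_vertex n (v : 'I_n -> vecspace R I) y x :
  conv_hull v x -> exists k, pairing y x <= pairing y (v k).
Proof.
case=> w [w0 w1 ->]; case: n v w w0 w1 => [|n] v w w0 w1.
  by move: w1; rewrite big_ord0 => /esym/eqP; rewrite oner_eq0.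
have [k _ kM] := arg_maxP (fun k => pairing y (v k)) (erefl (predT (@ord0 n))).
exists k; rewrite pairing_comb -[leRHS]mul1r -w1 mulr_suml; apply: ler_sum => j _.
by rewrite ler_wpM2l //; exact: kM.
Qed.

Lemma conv_hull_max_vertex n (v : 'I_n -> vecspace R I) y :
  conv_hull v !=set0 -> exists k, max_face (conv_hull v) y (v k).
Proof.
move=> [x /(conv_hull_le_vertex y)[k0 _]].
have [k _ kM] := arg_maxP (fun k => pairing y (v k)) (erefl (predT k0)).
exists k; split; first exact: vertex_in_conv_hull.
by move=> z /(conv_hull_le_vertex y)[j zj]; exact: le_trans zj (kM j _).
Qed.

Lemma max_face_neq0 p y : is_polytope p -> p !=set0 -> max_face p y !=set0.
Proof.
by move=> [n [v ->]] /(conv_hull_max_vertex y)[k vk]; exists (v k).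
Qed.

(** The face is generated by the maximizing generators; the others are replaced by
    one fixed maximizing generator, which keeps the index set unchanged.  In a
    convex combination lying in the face, the non-maximizing generators must have
    weight zero, since otherwise the mean would fall below the maximum. *)
Lemma max_face_polytope p y :
  is_polytope p -> p !=set0 -> is_polytope (max_face p y).
Proof.
move=> [n [v ->]] /(conv_hull_max_vertex y)[k0 vk0].
pose m := pairing y (v k0).
have vm k : pairing y (v k) <= m by exact: vk0.2 (vertex_in_conv_hull _ _).
pose v' k := if pairing y (v k) == m then v k else v k0.
have v'm k : pairing y (v' k) = m by rewrite /v'; case: eqP.
exists n, v'; apply/seteqP; split => x.
  move=> xF; have xm : pairing y x = m by exact: max_face_pairing xF vk0.
  case: xF xm => -[w [w0 w1 ->]] _; rewrite pairing_comb => wm.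
  (* Weighted shortfalls below the maximum: nonnegative, with zero sum. *)
  pose gap k := w k * (m - pairing y (v k)).
  have gap_ge0 k : 0 <= gap k by rewrite mulr_ge0 // subr_ge0.
  have gap_sum0 : \sum_k gap k = 0.
    by under eq_bigr do rewrite /gap mulrBr; rewrite sumrB -mulr_suml w1 mul1r wm subrr.
  have gap_eq0 k : gap k = 0 := psumr_eq0P (fun j _ => gap_ge0 j) gap_sum0 isT.
  exists w; split => //; apply/ffunP => i; rewrite !ffunE.
  apply: eq_bigr => k _; rewrite /v'; case: eqP => // /eqP vkm.
  have /eqP := gap_eq0 k; rewrite mulf_eq0 subr_eq0 [m == _]eq_sym (negbTE vkm) orbF.
  by move=> /eqP ->; rewrite !mul0r.
move=> x_conv; have xm : pairing y x = m.
  have [w [w0 w1 ->]] := x_conv; rewrite pairing_comb; under eq_bigr do rewrite v'm.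
  by rewrite -mulr_suml w1 mul1r.
split=> [|z /(vk0.2)]; last by rewrite xm.
suff /conv_hull_subset : forall k, conv_hull v (v' k) by apply.
by move=> k; rewrite /v'; case: ifP => _; exact: vertex_in_conv_hull.
Qed.

End Polytopes.

(** * Coordinates along a decomposition, and products *)

Section Pullback.
Variables (R : realType) (K L : choiceType) (I : {fset K}) (J : {fset L}).

(** Both [vproj] and relabelling along a bijection (through its inverse) have this
    form, so a single lemma covers the images of polytopes under either map. *)
Definition pull (g : J -> I) (x : vecspace R I) : vecspace R J :=
  [ffun j => x (g j)].

Lemma pull_polytope (g : J -> I) p : is_polytope p -> is_polytope (pull g @` p).
Proof.
have pull_comb n (w : 'I_n -> R) (v : 'I_n -> vecspace R I) :
    pull g [ffun i => \sum_k w k * v k i]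
    = [ffun j => \sum_k w k * pull g (v k) j].
  by apply/ffunP => j; rewrite !ffunE; apply: eq_bigr => k _; rewrite ffunE.
move=> [n [v ->]]; exists n, (pull g \o v); apply/seteqP; split => x.
  by move=> [_ [w [w0 w1 ->]] <-]; exists w; split=> //; rewrite pull_comb.
move=> [w [w0 w1 ->]]; exists [ffun i => \sum_k w k * v k i].
  by exists w; split.
by rewrite pull_comb.
Qed.
End Pullback.

Lemma insub_fincl (K : choiceType) (S I : {fset K}) (h : (S `<=` I)%fset) (a : S) :
  insub (val (fincl h a)) = Some a.
Proof. exact: valK. Qed.

Section Decomposition.
Variables (R : realType) (K : choiceType) (I S T : {fset K}) (d : decomp I S T).
Implicit Types (p : set (vecspace R S)) (q : set (vecspace R T)).
Let hS := decomp_subl d.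
Let hT := decomp_subr d.

Lemma val_fincl_decomp (b : T) : (val (fincl hT b) \in S) = false.
Proof.
case/andP: (d) => _ /fdisjointP_sym dST.
by apply/negbTE; apply: dST; exact: (fsvalP b).
Qed.

Lemma decomp_ind (P : I -> Prop) :
  (forall a, P (fincl hS a)) -> (forall b, P (fincl hT b)) -> forall i, P i.
Proof.
move=> PS PT i; have : val i \in (S `|` T)%fset.
  by case/andP: (d) => /eqP <- _; exact: valP.
rewrite in_fsetU => /orP[iS|iT].
  by have := PS [` iS]%fset; congr P; exact: val_inj.
by have := PT [` iT]%fset; congr P; exact: val_inj.
Qed.

Lemma sum_decomp (f : I -> R) :
  \sum_i f i = \sum_a f (fincl hS a) + \sum_b f (fincl hT b).
Proof.
rewrite (bigID (fun i : I => val i \in S)) /=; congr +%R.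
  rewrite (reindex_omap (fincl hS) (fun i => insub (val i))) => [|i iS].
    apply: eq_bigl => a; rewrite (valP a : val (fincl hS a) \in S) /=.
    by rewrite valK eqxx.
  by rewrite insubT /=; congr Some; exact: val_inj.
rewrite (reindex_omap (fincl hT) (fun i => insub (val i))) => [|i].
  by apply: eq_bigl => b; rewrite val_fincl_decomp /= valK eqxx.
elim/decomp_ind: i => [a /negP[]|b _]; first exact: (valP a).
by rewrite valK /=; congr Some; exact: val_inj.
Qed.

Lemma pairing_decomp (y : dualspace R I) x :
  pairing y x = pairing (vproj hS y) (vproj hS x) + pairing (vproj hT y) (vproj hT x).
Proof.
by rewrite /pairing sum_decomp; congr +%R; apply: eq_bigr => a _; rewrite !ffunE.
Qed.

(** When S and T decompose I, every index of I lies in one of them and the default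
    value 0 is never reached. *)
Definition glue (x : vecspace R S) (z : vecspace R T) : vecspace R I :=
  [ffun i => oapp x (oapp z 0 (insub (val i))) (insub (val i))].

Lemma glueL x z a : glue x z (fincl hS a) = x a.
Proof. by rewrite ffunE insub_fincl. Qed.

Lemma glueR x z b : glue x z (fincl hT b) = z b.
Proof. by rewrite ffunE insub_fincl [X in oapp x _ X]insubN ?val_fincl_decomp. Qed.

Lemma vproj_glueL x z : vproj hS (glue x z) = x.
Proof. by apply/ffunP => a; rewrite ffunE glueL. Qed.

Lemma vproj_glueR x z : vproj hT (glue x z) = z.
Proof. by apply/ffunP => b; rewrite ffunE glueR. Qed.

Lemma glue_vproj (x : vecspace R I) : glue (vproj hS x) (vproj hT x) = x.
Proof. by apply/ffunP; elim/decomp_ind => ?; rewrite ?glueL ?glueR ffunE. Qed.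

Lemma poly_prod_glue p q x z : p x -> q z -> poly_prod d p q (glue x z).
Proof. by move=> px qz; split; rewrite ?vproj_glueL ?vproj_glueR. Qed.

Lemma poly_prod_neq0 p q : p !=set0 -> q !=set0 -> poly_prod d p q !=set0.
Proof. by move=> [x px] [z qz]; exists (glue x z); exact: poly_prod_glue. Qed.

(** A point of one factor, glued to an arbitrary point of the other, gives a point of
    the product that projects back to it. *)
Lemma poly_prod_inj p q p' q' :
  p !=set0 -> q !=set0 -> p' !=set0 -> q' !=set0 ->
  poly_prod d p q = poly_prod d p' q' -> p = p' /\ q = q'.
Proof.
have subL (r r' : set (vecspace R S)) (s s' : set (vecspace R T)) : s !=set0 ->
    poly_prod d r s `<=` poly_prod d r' s' -> r `<=` r'.
  move=> [z sz] sub x rx; have [+ _] := sub _ (poly_prod_glue rx sz).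
  by rewrite vproj_glueL.
have subR (r r' : set (vecspace R S)) (s s' : set (vecspace R T)) : r !=set0 ->
    poly_prod d r s `<=` poly_prod d r' s' -> s `<=` s'.
  move=> [x rx] sub z sz; have [_ +] := sub _ (poly_prod_glue rx sz).
  by rewrite vproj_glueR.
move=> p0 q0 p'0 q'0 /seteqP[sub sub']; split; apply/seteqP; split.
- exact: subL sub.
- exact: subL sub'.
- exact: subR sub.
- exact: subR sub'.
Qed.

Lemma max_face_prod p q (y : dualspace R I) :
  max_face (poly_prod d p q) y =
  poly_prod d (max_face p (vproj hS y)) (max_face q (vproj hT y)).
Proof.
apply/seteqP; split => x.
  move=> [[px qx] xM]; split; split => // z hz.
    have := xM _ (poly_prod_glue hz qx).
    by rewrite !(pairing_decomp y) vproj_glueL vproj_glueR lerD2r.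
  have := xM _ (poly_prod_glue px hz).
  by rewrite !(pairing_decomp y) vproj_glueL vproj_glueR lerD2l.
move=> [[px xMp] [qx xMq]]; split => // z [pz qz].
by rewrite !(pairing_decomp y) lerD // ?xMp ?xMq.
Qed.

(** The product is generated by the glued pairs of generators: weights on the two
    factors multiply to weights on pairs, and weights on pairs have marginals on
    the two factors. *)
Lemma poly_prod_polytope p q :
  is_polytope p -> is_polytope q -> is_polytope (poly_prod d p q).
Proof.
move=> [m [u ->]] [n [v ->]].
pose vert (k : 'I_m * 'I_n) := glue (u k.1) (v k.2).
exists #|{: 'I_m * 'I_n}|, (vert \o enum_val).
have sum_pairs (f : 'I_m * 'I_n -> R) :
    \sum_(k < #|{: 'I_m * 'I_n}|) f (enum_val k) = \sum_k \sum_l f (k, l).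
  by rewrite -big_enum_val /= pair_big; apply: eq_bigr => -[].
apply/seteqP; split => x.
  move=> [[w [w0 w1 wx]] [c [c0 c1 cx]]].
  pose wc (k : 'I_m * 'I_n) := w k.1 * c k.2.
  exists (wc \o enum_val); split => [k||] /=; first exact: mulr_ge0.
    rewrite sum_pairs; under eq_bigr do rewrite /wc /= -mulr_sumr c1 mulr1.
    exact: w1.
  apply/ffunP; elim/decomp_ind => [a|b]; rewrite ffunE.
    rewrite (sum_pairs (fun k => wc k * vert k (fincl hS a))).
    have /ffunP/(_ a) := wx; rewrite !ffunE => ->; apply: eq_bigr => k _.
    under eq_bigr do rewrite /wc /vert /= glueL mulrAC.
    by rewrite -mulr_sumr c1 mulr1.
  rewrite (sum_pairs (fun k => wc k * vert k (fincl hT b))).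
  have /ffunP/(_ b) := cx; rewrite !ffunE => ->.
  rewrite exchange_big; apply: eq_bigr => l _.
  under eq_bigr do rewrite /wc /vert /= glueR -mulrA.
  by rewrite -mulr_suml w1 mul1r.
move=> [w [w0 w1 ->]].
pose W (k : 'I_m * 'I_n) := w (enum_rank k).
have W1 : \sum_k \sum_l W (k, l) = 1.
  by rewrite -w1 -sum_pairs; apply: eq_bigr => k _; rewrite /W enum_valK.
have WE i : \sum_k w k * (vert \o enum_val) k i =
            \sum_k \sum_l W (k, l) * glue (u k) (v l) i.
  rewrite -(sum_pairs (fun k => W k * vert k i)).
  by apply: eq_bigr => k _; rewrite /W enum_valK.
split.
  exists (fun k => \sum_l W (k, l)); split => // [k|].
    by rewrite sumr_ge0 // => l _; exact: w0.
  apply/ffunP => a; rewrite !ffunE WE; apply: eq_bigr => k _.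
  by rewrite mulr_suml; apply: eq_bigr => l _; rewrite glueL.
exists (fun l => \sum_k W (k, l)); split => // [l||].
- by rewrite sumr_ge0 // => k _; exact: w0.
- by rewrite exchange_big.
apply/ffunP => b; rewrite !ffunE WE exchange_big; apply: eq_bigr => l _.
by rewrite mulr_suml; apply: eq_bigr => k _; rewrite glueR.
Qed.
End Decomposition.

Arguments decomp_ind {K I S T} d P _ _ i.
Arguments glue_vproj {R K I S T} d x.
Arguments pairing_decomp {R K I S T} d y x.

(** * Generalized permutahedra *)

Section GenPermutahedron.
Variables (R : realType) (K : choiceType) (I : {fset K}).
Implicit Types (p : set (vecspace R I)) (y : dualspace R I) (x : vecspace R I).

Lemma braid_face_refl y : braid_face y y.
Proof. by move=> i j; split => // /ltW. Qed.

(** The functional y0 lies in the relative interior of its closed braid face, so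
    one can move from y through y0 and a little beyond while staying in the face.
    Up to scaling, this is c y0 - y for large c. *)
Lemma braid_face_opposite y0 y : braid_face y0 y ->
  exists2 c, 0 < c & braid_face y0 [ffun i => c * y0 i + (- 1) * y i].
Proof.
move=> y0y; pose r (k : I * I) := `|y k.2 - y k.1| / `|y0 k.2 - y0 k.1|.
have r_ge0 k : 0 <= r k by rewrite divr_ge0.
(* On a pair with y0 i < y0 j, any c >= r (i, j) preserves the order. *)
exists (1 + \sum_k r k) => [|i j]; first by rewrite ltr_pwDl // sumr_ge0.
rewrite !ffunE; split => [yij|ltij]; first by rewrite yij ((y0y i j).1 yij).
rewrite !mulN1r lerBlDr addrAC -lerBlDr opprK -lerBrDl.
suff : y j - y i <= (1 + \sum_k r k) * (y0 j - y0 i) by rewrite mulrBr; lra.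
have gt0 : 0 < y0 j - y0 i by rewrite subr_gt0.
rewrite -ler_pdivrMr //; apply: le_trans (_ : r (i, j) <= _).
  by rewrite /r /= (gtr0_norm gt0) ler_wpM2r ?ler_norm // invr_ge0 ltW.
rewrite (bigD1 (i, j)) //= addrCA lerDl addr_ge0 // sumr_ge0 //.
Qed.

(** The point v maximizes y0 as well as y and the opposite functional c y0 - y.  A
    maximizer x of y0 agrees with v on y0, hence cannot do worse than v on y
    without beating it on c y0 - y. *)
Lemma max_face_refine p v y0 y :
  (forall y', braid_face y0 y' -> max_face p y' v) -> braid_face y0 y ->
  max_face p y0 `<=` max_face p y.
Proof.
move=> vM y0y x xM; have [c c0 /vM vM'] := braid_face_opposite y0y.
have e := max_face_pairing xM (vM _ (@braid_face_refl y0)).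
have [_ /(_ _ xM.1)] := vM'; rewrite !pairing_lin e lerD2l !mulN1r lerN2 => yv.
split; first exact: xM.1.
by move=> z /((vM _ y0y).2) zv; exact: le_trans zv yv.
Qed.

Lemma gen_permutahedron_of_common_max p : is_polytope p -> p !=set0 ->
  (forall y0, exists v, forall y, braid_face y0 y -> max_face p y v) ->
  is_gen_permutahedron p.
Proof.
move=> pP p0 vM; split => // C [y0 ->].
exists (normal_cone p (max_face p y0)); first by exists (max_face p y0); [exists y0|].
by have [v vM0] := vM y0; move=> y; exact: max_face_refine vM0.
Qed.

Lemma gen_permutahedron_max_face p y0 y : is_gen_permutahedron p ->
  braid_face y0 y -> max_face p y0 `<=` max_face p y.
Proof.
move=> [pP p0 /(_ _ (ex_intro _ y0 erefl))[_ [_ [y1 ->] ->] sub]].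
have [v vM] := max_face_neq0 y1 pP p0.
by apply: (@max_face_refine p v) => y' /sub; exact.
Qed.

Lemma gen_permutahedron_common_max p y0 : is_gen_permutahedron p ->
  exists v, forall y, braid_face y0 y -> max_face p y v.
Proof.
move=> pG; have [pP p0 _] := pG; have [v vM] := max_face_neq0 y0 pP p0.
by exists v => y y0y; exact: gen_permutahedron_max_face vM.
Qed.

Variable S : {fset K}.

(** The closed face of y0 in the subarrangement of the hyperplanes y(i) = y(j) with
    i and j on the same side of the decomposition: comparisons between S and its
    complement are left free. *)
Definition blockwise_braid_face y0 : set (dualspace R I) :=
  [set y | forall i j : I, (val i \in S) = (val j \in S) ->
     (y0 i = y0 j -> y i = y j) /\ (y0 i < y0 j -> y i <= y j)].

(* Twice the l1-norm of y bounds all differences of its coordinates, so this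
   multiple of the indicator puts S strictly above its complement. *)
Let shift y : dualspace R I :=
  [ffun i => (1 + 2 * \sum_i `|y i|) * indicator R I S i + 1 * y i].

Let lt_shift y i j : val i \in S -> val j \notin S -> shift y j < shift y i.
Proof.
move=> iS jS; rewrite !ffunE iS (negbTE jS) mulr0 mulr1 add0r !mul1r.
have le_norm1 k : `|y k| <= \sum_i `|y i|.
  by rewrite (bigD1 k) //= lerDl sumr_ge0.
have := ler_norm (y j); have := lerNnormlW (lexx `|y i|).
have := le_norm1 i; have := le_norm1 j; lra.
Qed.

Let shiftE y i : shift y i = (1 + 2 * \sum_i `|y i|) * (val i \in S)%:R + y i.
Proof. by rewrite !ffunE mul1r. Qed.

Let braid_face_shift y0 y :
  blockwise_braid_face y0 y -> braid_face (shift y0) (shift y).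
Proof.
move=> y0y i j; have [ij|] := eqVneq (val i \in S) (val j \in S).
  rewrite !shiftE ij; split => [/addrI|]; first by move/(y0y i j ij).1 => ->.
  by rewrite ltrD2l lerD2l; exact: (y0y i j ij).2.
have [iS|iS] := boolP (val i \in S); have [jS|jS] := boolP (val j \in S) => // _.
  by split=> h; have := lt_shift y0 iS jS; rewrite ?h ?ltxx // ltNge (ltW h).
split=> h; last exact/ltW/lt_shift.
by have := lt_shift y0 jS iS; rewrite h ltxx.
Qed.

Let braid_face_shift_indicator y0 : braid_face (shift y0) (indicator R I S).
Proof.
move=> i j; rewrite [indicator _ _ _ i]ffunE [indicator _ _ _ j]ffunE.
have [iS|iS] := boolP (val i \in S); have [jS|jS] := boolP (val j \in S) => //.
  by split=> h; have := lt_shift y0 iS jS; rewrite ?h ?ltxx // ltNge (ltW h).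
split=> h; last exact: ler0n.
by have := lt_shift y0 jS iS; rewrite h ltxx.
Qed.

(** Adding large multiples of 1_S to y0 and y turns the blockwise condition into
    membership in one braid face, which also contains 1_S itself.  A common
    maximizer of that braid face lies in the face of 1_S, where 1_S is constant
    and the added multiples no longer matter. *)
Lemma blockwise_common_max p y0 : is_gen_permutahedron p ->
  exists2 v, max_face p (indicator R I S) v &
    forall y, blockwise_braid_face y0 y ->
      max_face (max_face p (indicator R I S)) y v.
Proof.
move=> pG; have [v vM] := gen_permutahedron_common_max (shift y0) pG.
have vF := vM _ (@braid_face_shift_indicator y0).
exists v => // y /braid_face_shift /vM[_ vy]; split=> // z zF.
have := vy z zF.1; rewrite !pairing_lin (max_face_pairing zF vF) lerD2l.
by rewrite !mul1r.
Qed.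
End GenPermutahedron.

Section Factorization.
Variables (R : realType) (K : choiceType) (I S T : {fset K}) (d : decomp I S T).
Let hS := decomp_subl d.
Let hT := decomp_subr d.

Lemma blockwise_glue (y0 y : dualspace R S) (z0 z : dualspace R T) :
  braid_face y0 y -> braid_face z0 z ->
  blockwise_braid_face S (glue I y0 z0) (glue I y z).
Proof.
move=> y0y z0z; elim/(decomp_ind d) => [a|b]; elim/(decomp_ind d) => [a'|b'].
- by move=> _; rewrite !glueL; exact: y0y.
- by rewrite val_fincl_decomp (valP a : val (fincl hS a) \in S).
- by rewrite val_fincl_decomp (valP a' : val (fincl hS a') \in S).
- by move=> _; rewrite !glueR; exact: z0z.
Qed.

Lemma pairing_glue (y : dualspace R S) (z : dualspace R T) (x : vecspace R I) :
  pairing (glue I y z) x = pairing y (vproj hS x) + pairing z (vproj hT x).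
Proof. by rewrite (pairing_decomp d) vproj_glueL vproj_glueR. Qed.

Lemma pairing0 (L : choiceType) (J : {fset L}) (x : vecspace R J) :
  pairing [ffun=> 0] x = 0.
Proof. by rewrite /pairing big1 // => i _; rewrite ffunE mul0r. Qed.

Lemma braid_face0 (L : choiceType) (J : {fset L}) (y : dualspace R J) :
  braid_face y [ffun=> 0].
Proof. by move=> i j; rewrite !ffunE. Qed.

Variable p : set (vecspace R I).
Hypothesis pG : is_gen_permutahedron p.
Let F := max_face p (indicator R I S).

(** If y separated from F a point x whose projections are those of a and b in F,
    a point m of F maximizing both the S-part and the T-part of y would satisfy
    y(x) = y_S(a) + y_T(b) <= y_S(m) + y_T(m) = y(m), a contradiction. *)
Lemma indicator_face_prod :
  F = poly_prod d (vproj hS @` F) (vproj hT @` F).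
Proof.
apply/seteqP; split => [x xF|x [[a aF ax] [b bF bx]]]; first by split; exists x.
have [pP p0 _] := pG; have [n [v Fv]] := max_face_polytope (indicator R I S) pP p0.
have [[w [w0 w1 ->]]|[y yx]] := convex_separation v x.
  by rewrite /F Fv; exists w.
have [m mF mM] := blockwise_common_max S y pG.
pose yS : dualspace R I := glue I (vproj hS y) ([ffun=> 0] : vecspace R T).
pose yT : dualspace R I := glue I ([ffun=> 0] : vecspace R S) (vproj hT y).
have yE x' : pairing y x' = pairing yS x' + pairing yT x'.
  by rewrite (pairing_decomp d) !pairing_glue !pairing0 addr0 add0r.
have ySM : pairing yS x <= pairing yS m.
  have -> : pairing yS x = pairing yS a by rewrite !pairing_glue !pairing0 ax.
  have := blockwise_glue (@braid_face_refl _ _ _ (vproj hS y))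
    (@braid_face0 _ _ (vproj hT y)).
  by rewrite glue_vproj => /mM[_]; apply.
have yTM : pairing yT x <= pairing yT m.
  have -> : pairing yT x = pairing yT b by rewrite !pairing_glue !pairing0 bx.
  have := blockwise_glue (@braid_face0 _ _ (vproj hS y))
    (@braid_face_refl _ _ _ (vproj hT y)).
  by rewrite glue_vproj => /mM[_]; apply.
have : conv_hull v m by rewrite -Fv.
move=> /(conv_hull_le_vertex y)[k mk].
have : pairing y x <= pairing y (v k) by apply: le_trans mk; rewrite !yE lerD.
by rewrite leNgt (yx k : pairing y (v k) < pairing y x).
Qed.

(** The blockwise common maximizers for functionals extended by zero from S to I
    project to common maximizers of whole braid faces. *)
Lemma gen_permutahedron_restriction : is_gen_permutahedron (vproj hS @` F).
Proof.
have [pP p0 _] := pG; apply: gen_permutahedron_of_common_max.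
- exact: (pull_polytope (fincl hS)) (max_face_polytope _ pP p0).
- have [x xF] := max_face_neq0 (indicator R I S) pP p0.
  by exists (vproj hS x), x.
move=> y0; pose z0 : dualspace R T := [ffun=> 0].
have [m mF mM] := blockwise_common_max S (glue I y0 z0) pG.
exists (vproj hS m) => y y0y; split; first by exists m.
move=> _ [z zF <-].
have [_ /(_ _ zF)] := mM _ (blockwise_glue y0y (@braid_face0 _ _ _)).
by rewrite !pairing_glue !pairing0 !addr0.
Qed.

Lemma gen_permutahedron_contraction : is_gen_permutahedron (vproj hT @` F).
Proof.
have [pP p0 _] := pG; apply: gen_permutahedron_of_common_max.
- exact: (pull_polytope (fincl hT)) (max_face_polytope _ pP p0).
- have [x xF] := max_face_neq0 (indicator R I S) pP p0.
  by exists (vproj hT x), x.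
move=> z0; pose y0 : dualspace R S := [ffun=> 0].
have [m mF mM] := blockwise_common_max S (glue I y0 z0) pG.
exists (vproj hT m) => z z0z; split; first by exists m.
move=> _ [x xF <-].
have [_ /(_ _ xF)] := mM _ (blockwise_glue (@braid_face0 _ _ _) z0z).
by rewrite !pairing_glue !pairing0 !add0r.
Qed.
End Factorization.

Lemma gen_permutahedron_prod (R : realType) (K : choiceType) (I S T : {fset K})
    (d : decomp I S T) (p : set (vecspace R S)) (q : set (vecspace R T)) :
  is_gen_permutahedron p -> is_gen_permutahedron q ->
  is_gen_permutahedron (poly_prod d p q).
Proof.
move=> pG qG; have [pP p0 _] := pG; have [qP q0 _] := qG.
apply: gen_permutahedron_of_common_max.
- exact: poly_prod_polytope.
- exact: poly_prod_neq0.
move=> y0.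
have [u uM] := gen_permutahedron_common_max (vproj (decomp_subl d) y0) pG.
have [v vM] := gen_permutahedron_common_max (vproj (decomp_subr d) y0) qG.
exists (glue I u v) => y y0y; rewrite max_face_prod; apply: poly_prod_glue.
  by apply: uM => i j; rewrite !ffunE; exact: y0y.
by apply: vM => i j; rewrite !ffunE; exact: y0y.
Qed.

Lemma gen_permutahedron_point (R : realType) (K : choiceType) :
  is_gen_permutahedron [set: vecspace R (fset0 : {fset K})].
Proof.
have eq0 (x x' : vecspace R (fset0 : {fset K})) : x = x'.
  by apply/ffunP => -[].
apply: gen_permutahedron_of_common_max.
- exists 1%N, (fun=> [ffun=> 0]); apply/seteqP; split => // x _.
  by rewrite (eq0 x [ffun=> 0]); exact: (vertex_in_conv_hull (fun=> _) ord0).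
- by exists [ffun=> 0].
by move=> y0; exists [ffun=> 0] => y _; split=> // z _; rewrite (eq0 z [ffun=> 0]).
Qed.

(** * Relabelling along a bijection *)

Section Relabelling.
Variables (R : realType) (K L : choiceType) (I : {fset K}) (J : {fset L}).
Variables (s : I -> J) (bij_s : bijective s).

Lemma relabelE (x : vecspace R I) i : relabel s x (s i) = x i.
Proof. by rewrite ffunE (big_pred1 i) // => j; exact/bij_eq. Qed.

Lemma pull_relabel (x : vecspace R I) : pull s (relabel s x) = x.
Proof. by apply/ffunP => i; rewrite ffunE relabelE. Qed.

Lemma relabel_pull (x : vecspace R J) : relabel s (pull s x) = x.
Proof.
by have [t _ tK] := bij_s; apply/ffunP => j; rewrite -[j]tK relabelE ffunE.
Qed.

Lemma image_relabel (p : set (vecspace R I)) : relabel s @` p = pull s @^-1` p.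
Proof.
apply/seteqP; split => x; first by move=> [z pz <-]; rewrite /= pull_relabel.
by move=> px; exists (pull s x) => //; exact: relabel_pull.
Qed.

Lemma pairing_pull (y : dualspace R J) (x : vecspace R J) :
  pairing (pull s y) (pull s x) = pairing y x.
Proof.
rewrite [RHS](reindex s) /=; last exact: onW_bij.
by apply: eq_bigr => i _; rewrite !ffunE.
Qed.

Lemma max_face_relabel (p : set (vecspace R I)) (y : dualspace R J) :
  max_face (relabel s @` p) y = relabel s @` max_face p (pull s y).
Proof.
rewrite !image_relabel; apply/seteqP; split => x [px xM]; split => // z pz.
  by have := xM (relabel s z); rewrite /= pull_relabel -!pairing_pull pull_relabel; apply.
by have := xM _ pz; rewrite !pairing_pull.
Qed.

Lemma gen_permutahedron_relabel (p : set (vecspace R I)) :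
  is_gen_permutahedron p -> is_gen_permutahedron (relabel s @` p).
Proof.
move=> pG; have [pP p0 _] := pG; apply: gen_permutahedron_of_common_max.
- have [t sK tK] := bij_s.
  have -> : relabel s @` p = pull t @` p; last exact: pull_polytope.
  apply: eq_imagel => x _; apply/ffunP => j.
  by rewrite [RHS]ffunE -[j in LHS]tK relabelE.
- by have [x px] := p0; exists (relabel s x), x.
move=> y0; have [v vM] := gen_permutahedron_common_max (pull s y0) pG.
exists (relabel s v) => y y0y; rewrite max_face_relabel; exists v => //.
by apply: vM => i j; rewrite !ffunE; exact: y0y.
Qed.
End Relabelling.

(** * Identities between products *)

Section ProductIdentities.
Variables (R : realType) (K : choiceType).
Implicit Types I S T : {fset K}.

Lemma vproj_id I (h : (I `<=` I)%fset) (x : vecspace R I) : vproj h x = x.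
Proof. by apply/ffunP => i; rewrite ffunE; congr (x _); exact: val_inj. Qed.

Lemma vproj_vproj I S S' A (hAS : (A `<=` S)%fset) (hS : (S `<=` I)%fset)
    (hAS' : (A `<=` S')%fset) (hS' : (S' `<=` I)%fset) (x : vecspace R I) :
  vproj hAS (vproj hS x) = vproj hAS' (vproj hS' x).
Proof. by apply/ffunP => a; rewrite !ffunE; congr (x _); exact: val_inj. Qed.

Lemma vproj_vproj1 I S A (hAS : (A `<=` S)%fset) (hS : (S `<=` I)%fset)
    (hA : (A `<=` I)%fset) (x : vecspace R I) :
  vproj hAS (vproj hS x) = vproj hA x.
Proof. by apply/ffunP => a; rewrite !ffunE; congr (x _); exact: val_inj. Qed.

Lemma vproj_indicator I S (h : (S `<=` I)%fset) (U V : {fset K}) :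
  {in S, forall k, (k \in U) = (k \in V)} ->
  vproj h (indicator R I U) = indicator R S V.
Proof.
by move=> UV; apply/ffunP => a; rewrite !ffunE; congr (_%:R); rewrite UV ?(valP a).
Qed.

Lemma poly_prodA (I A B C AB BC : {fset K})
    (d1 : decomp I AB C) (d2 : decomp AB A B)
    (d3 : decomp I A BC) (d4 : decomp BC B C)
    (p : set (vecspace R A)) (q : set (vecspace R B)) (r : set (vecspace R C)) :
  poly_prod d3 p (poly_prod d4 q r) = poly_prod d1 (poly_prod d2 p q) r.
Proof.
apply/seteqP; split => x; rewrite /poly_prod /=.
  rewrite (vproj_vproj1 _ _ (decomp_subr d1)).
  rewrite (vproj_vproj _ _ (decomp_subr d2) (decomp_subl d1)).
  by rewrite (vproj_vproj1 _ _ (decomp_subl d3)); tauto.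
rewrite (vproj_vproj1 _ _ (decomp_subl d3)).
rewrite (vproj_vproj _ _ (decomp_subl d4) (decomp_subr d3)).
by rewrite (vproj_vproj1 _ _ (decomp_subr d1)); tauto.
Qed.

Lemma poly_prod_interchange (I S T S' T' A B C D : {fset K})
    (d : decomp I S T) (dS : decomp S A B) (dT : decomp T C D)
    (d' : decomp I S' T') (dS' : decomp S' A C) (dT' : decomp T' B D)
    (p : set (vecspace R A)) (q : set (vecspace R B))
    (r : set (vecspace R C)) (s : set (vecspace R D)) :
  poly_prod d (poly_prod dS p q) (poly_prod dT r s) =
  poly_prod d' (poly_prod dS' p r) (poly_prod dT' q s).
Proof.
have eA := vproj_vproj (decomp_subl dS) (decomp_subl d) (decomp_subl dS') (decomp_subl d').
have eB := vproj_vproj (decomp_subr dS) (decomp_subl d) (decomp_subl dT') (decomp_subr d').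
have eC := vproj_vproj (decomp_subl dT) (decomp_subr d) (decomp_subr dS') (decomp_subl d').
have eD := vproj_vproj (decomp_subr dT) (decomp_subr d) (decomp_subr dT') (decomp_subr d').
by apply/seteqP; split => x; rewrite /poly_prod /= eA eB eC eD; tauto.
Qed.

End ProductIdentities.

(** * The Hopf monoid *)

Section Operations.
Variable R : realType.

Lemma GP_ext (K : choiceType) (I : {fset K}) (p q : GP R I) :
  sval p = sval q -> p = q.
Proof. by apply: eq_sig_hprop => *; exact: Prop_irrelevance. Qed.

Lemma GP_neq0 (K : choiceType) (I : {fset K}) (p : GP R I) : sval p !=set0.
Proof. by have [_] := svalP p. Qed.

Definition GP_map (K L : choiceType) (I : {fset K}) (J : {fset L}) (s : I -> J)
    (bij_s : bijective s) (p : GP R I) : GP R J :=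
  exist _ _ (gen_permutahedron_relabel bij_s (svalP p)).

Definition GP_one (K : choiceType) : GP R (fset0 : {fset K}) :=
  exist _ _ (gen_permutahedron_point R K).

Lemma GP_map_id (K : choiceType) (I : {fset K}) (hid : bijective (fun i : I => i))
    (p : GP R I) : GP_map hid p = p.
Proof.
apply: GP_ext; rewrite /= image_relabel //; apply/seteqP.
by split => x /=; rewrite (_ : pull id x = x) //; apply/ffunP => i; rewrite ffunE.
Qed.

Lemma GP_map_comp (K L M : choiceType) (I : {fset K}) (J : {fset L})
    (N : {fset M}) (s : I -> J) (t : J -> N) (hs : bijective s)
    (ht : bijective t) (hts : bijective (fun i => t (s i))) (p : GP R I) :
  GP_map hts p = GP_map ht (GP_map hs p).
Proof.
apply: GP_ext; rewrite /= !image_relabel //; apply/seteqP.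
by split => x /=; rewrite (_ : pull _ x = pull s (pull t x)) //;
  apply/ffunP => i; rewrite !ffunE.
Qed.

Definition GP_species : set_species (@GP R) := SetSpecies GP_map_id GP_map_comp.

Section Decomposition.
Variables (K : choiceType) (I S T : {fset K}) (d : decomp I S T).

Definition GP_mul (p : GP R S) (q : GP R T) : GP R I :=
  exist _ _ (gen_permutahedron_prod d (svalP p) (svalP q)).

Definition GP_res (p : GP R I) : GP R S :=
  exist _ _ (gen_permutahedron_restriction d (svalP p)).

Definition GP_con (p : GP R I) : GP R T :=
  exist _ _ (gen_permutahedron_contraction d (svalP p)).

Lemma GP_face (p : GP R I) :
  max_face (sval p) (indicator R I S) = sval (GP_mul (GP_res p) (GP_con p)).
Proof. exact: indicator_face_prod (svalP p). Qed.

Lemma GP_mul_inj (p p' : GP R S) (q q' : GP R T) :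
  GP_mul p q = GP_mul p' q' -> p = p' /\ q = q'.
Proof.
move=> /(congr1 sval)/(poly_prod_inj (GP_neq0 _) (GP_neq0 _) (GP_neq0 _) (GP_neq0 _)).
by move=> [pp' qq']; split; exact: GP_ext.
Qed.

(** The way to identify a restriction and a contraction: write the face of 1_S as a
    product. *)
Lemma GP_coproduct_unique (p : GP R I) (p1 : GP R S) (p2 : GP R T) :
  max_face (sval p) (indicator R I S) = sval (GP_mul p1 p2) ->
  GP_res p = p1 /\ GP_con p = p2.
Proof. by rewrite GP_face => /GP_ext/GP_mul_inj. Qed.
End Decomposition.

Lemma GP_fset0 (K : choiceType) (p : GP R (fset0 : {fset K})) : p = GP_one K.
Proof.
apply: GP_ext; have [x px] := GP_neq0 p; apply/seteqP; split => // z _.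
by rewrite (_ : z = x) //; apply/ffunP => -[].
Qed.

Lemma GP_mul1 (K : choiceType) (I : {fset K}) (d : decomp I I fset0) (p : GP R I) :
  GP_mul d p (GP_one K) = p.
Proof.
by apply: GP_ext; apply/seteqP; split => x; rewrite /= /poly_prod /= vproj_id //; case.
Qed.

Lemma GP_1mul (K : choiceType) (I : {fset K}) (d : decomp I fset0 I) (p : GP R I) :
  GP_mul d (GP_one K) p = p.
Proof.
by apply: GP_ext; apply/seteqP; split => x; rewrite /= /poly_prod /= vproj_id //; case.
Qed.

(** A generalized permutahedron lies in a hyperplane where the sum of the
    coordinates is constant: constant functionals are in the braid face of 0, so
    every maximizer of 0 maximizes them. *)
Lemma GP_max_face_const (K : choiceType) (I : {fset K}) (c : R) (p : GP R I) :
  max_face (sval p) [ffun=> c] = sval p.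
Proof.
apply/seteqP; split => [x []//|x px].
apply: (gen_permutahedron_max_face (svalP p) (y0 := [ffun=> 0])).
  by move=> i j; rewrite !ffunE ltxx.
by split => // z _; rewrite !pairing0.
Qed.

Lemma GP_res_all (K : choiceType) (I : {fset K}) (d : decomp I I fset0) (p : GP R I) :
  GP_res d p = p.
Proof.
have [] // := @GP_coproduct_unique _ _ _ _ d p p (GP_one K).
rewrite GP_mul1 (_ : indicator R I I = [ffun=> 1]) ?GP_max_face_const //.
by apply/ffunP => i; rewrite !ffunE (valP i).
Qed.

Lemma GP_con_none (K : choiceType) (I : {fset K}) (d : decomp I fset0 I) (p : GP R I) :
  GP_con d p = p.
Proof.
have [] // := @GP_coproduct_unique _ _ _ _ d p (GP_one K) p.
rewrite GP_1mul (_ : indicator R I fset0 = [ffun=> 0]) ?GP_max_face_const //.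
Qed.

Section Naturality.
Variables (K L : choiceType) (I S T : {fset K}) (J S' T' : {fset L}).
Variables (d : decomp I S T) (d' : decomp J S' T').
Variables (s : I -> J) (sS : S -> S') (sT : T -> T').
Variables (hs : bijective s) (hS : bijective sS) (hT : bijective sT).
Hypotheses (rS : restricts s sS) (rT : restricts s sT).

Lemma GP_mul_nat (p : GP R S) (q : GP R T) :
  GP_map hs (GP_mul d p q) = GP_mul d' (GP_map hS p) (GP_map hT q).
Proof.
apply: GP_ext; rewrite /= !image_relabel // /poly_prod.
have eS (x : vecspace R J) :
    vproj (decomp_subl d) (pull s x) = pull sS (vproj (decomp_subl d') x).
  by apply/ffunP => a; rewrite !ffunE; congr (x _); apply: val_inj; exact: rS.
have eT (x : vecspace R J) :
    vproj (decomp_subr d) (pull s x) = pull sT (vproj (decomp_subr d') x).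
  by apply/ffunP => b; rewrite !ffunE; congr (x _); apply: val_inj; exact: rT.
by apply/seteqP; split => x; rewrite /= eS eT.
Qed.

(** Rephrases that s maps S into S' and T into T'. *)
Lemma pull_indicator : pull s (indicator R J S') = indicator R I S.
Proof.
apply/ffunP; elim/(decomp_ind d) => [a|b]; rewrite !ffunE.
  by rewrite (rS (erefl : val (fincl _ a) = val a)) (valP (sS a)) (valP a).
rewrite (rT (erefl : val (fincl _ b) = val b)) (val_fincl_decomp d b).
by rewrite (val_fincl_decomp d' (sT b) : (val (sT b) \in S') = false).
Qed.

Lemma GP_coproduct_nat (p : GP R I) :
  GP_res d' (GP_map hs p) = GP_map hS (GP_res d p) /\
  GP_con d' (GP_map hs p) = GP_map hT (GP_con d p).
Proof.
apply: GP_coproduct_unique.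
by rewrite -GP_mul_nat [LHS](max_face_relabel hs) pull_indicator (GP_face d).
Qed.
End Naturality.

(** Both iterated faces consist of the points of p maximizing y and z
    simultaneously, as soon as there is such a point. *)
Lemma max_face_comm (K : choiceType) (I : {fset K}) (p : set (vecspace R I))
    (y z : dualspace R I) v :
  max_face p y v -> max_face p z v ->
  max_face (max_face p y) z = max_face (max_face p z) y.
Proof.
have sub y' z' : max_face p y' v -> max_face p z' v ->
    max_face (max_face p y') z' `<=` max_face (max_face p z') y'.
  move=> vy vz x [xy xz]; have e := max_face_pairing xy vy.
  split=> [|w [pw _]]; last by rewrite xy.2.
  by split=> [|w /(vz.2) wv]; [exact: xy.1|exact: le_trans wv (xz _ vy)].
by move=> vy vz; apply/seteqP; split; exact: sub.
Qed.

Section Coassociativity.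
Variables (K : choiceType) (I A B C AB BC : {fset K}).
Variables (d1 : decomp I AB C) (d2 : decomp AB A B).
Variables (d3 : decomp I A BC) (d4 : decomp BC B C).

Lemma GP_mulA (p : GP R A) (q : GP R B) (r : GP R C) :
  GP_mul d3 p (GP_mul d4 q r) = GP_mul d1 (GP_mul d2 p q) r.
Proof. by apply: GP_ext; exact: poly_prodA. Qed.

Let memAB k : (k \in AB) = (k \in A) || (k \in B).
Proof. by case/andP: d2 => /eqP -> _; rewrite in_fsetU. Qed.

(** A common maximizer of 1_A and 1_AB is provided by the functional 1_A + 1_AB,
    whose braid face contains both. *)
Lemma nested_indicator_faces (p : GP R I) :
  max_face (max_face (sval p) (indicator R I AB)) (indicator R I A) =
  max_face (max_face (sval p) (indicator R I A)) (indicator R I AB).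
Proof.
pose y : dualspace R I := [ffun i => (val i \in A)%:R + (val i \in AB)%:R].
have [v vM] := gen_permutahedron_common_max y (svalP p).
apply: (@max_face_comm _ _ _ _ _ v); apply: vM => i j; rewrite !ffunE !memAB;
  case: (val i \in A) (val i \in B) (val j \in A) (val j \in B);
  by do 3 case=> //=; split; lra.
Qed.

(** Both sides of [nested_indicator_faces] are triple products.  On the 1_AB-face,
    1_A only sees the restriction to AB; on the 1_A-face, 1_AB is constant on the
    restriction to A and is 1_B on the contraction. *)
Lemma GP_coassoc (p : GP R I) :
  [/\ GP_res d2 (GP_res d1 p) = GP_res d3 p,
      GP_con d2 (GP_res d1 p) = GP_res d4 (GP_con d3 p)
    & GP_con d1 p = GP_con d4 (GP_con d3 p)].
Proof.
have ABface : max_face (max_face (sval p) (indicator R I AB)) (indicator R I A) =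
    sval (GP_mul d1 (GP_mul d2 (GP_res d2 (GP_res d1 p)) (GP_con d2 (GP_res d1 p)))
                    (GP_con d1 p)).
  rewrite (GP_face d1) max_face_prod; congr poly_prod.
    by rewrite (@vproj_indicator _ _ _ _ _ _ A) ?(GP_face d2).
  rewrite (@vproj_indicator _ _ _ _ _ _ fset0) => [|k kC].
    rewrite (_ : indicator R C fset0 = [ffun=> 0]) ?GP_max_face_const //.
  rewrite in_fset0; case/andP: d1 => _ /fdisjointP_sym/(_ k kC).
  by rewrite memAB => /norP[/negbTE].
have Aface : max_face (max_face (sval p) (indicator R I A)) (indicator R I AB) =
    sval (GP_mul d3 (GP_res d3 p)
      (GP_mul d4 (GP_res d4 (GP_con d3 p)) (GP_con d4 (GP_con d3 p)))).
  rewrite (GP_face d3) max_face_prod; congr poly_prod.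
    rewrite (@vproj_indicator _ _ _ _ _ _ A) => [|k kA]; last by rewrite memAB kA.
    rewrite (_ : indicator R A A = [ffun=> 1]) ?GP_max_face_const //.
    by apply/ffunP => i; rewrite !ffunE (valP i).
  rewrite (@vproj_indicator _ _ _ _ _ _ B) ?(GP_face d4) // => k kBC.
  case/andP: d3 => _ /fdisjointP_sym/(_ k kBC) /negbTE kA.
  by rewrite memAB kA.
move: ABface; rewrite nested_indicator_faces Aface GP_mulA.
by move=> /GP_ext/GP_mul_inj[/GP_mul_inj[-> ->] ->].
Qed.
End Coassociativity.

Section Compatibility.
Variables (K : choiceType) (I S T S' T' : {fset K}).
Variables (d : decomp I S T) (d' : decomp I S' T').
Variables (dS : decomp S (S `&` S')%fset (S `&` T')%fset).
Variables (dT : decomp T (T `&` S')%fset (T `&` T')%fset).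
Variables (dS' : decomp S' (S `&` S')%fset (T `&` S')%fset).
Variables (dT' : decomp T' (S `&` T')%fset (T `&` T')%fset).

(** On the product, 1_S' is the sum of the indicators of the two intersections with
    S', so its face is a product of two faces, each of which is again a product;
    the four factors are then regrouped. *)
Lemma GP_compat (p : GP R S) (q : GP R T) :
  GP_res d' (GP_mul d p q) = GP_mul dS' (GP_res dS p) (GP_res dT q) /\
  GP_con d' (GP_mul d p q) = GP_mul dT' (GP_con dS p) (GP_con dT q).
Proof.
apply: GP_coproduct_unique; rewrite [LHS]max_face_prod.
apply: etrans (poly_prod_interchange d dS dT d' dS' dT' _ _ _ _); congr poly_prod.
  rewrite (@vproj_indicator _ _ _ _ _ _ (S `&` S')%fset) => [|k kS].
    exact: GP_face.
  by rewrite in_fsetI kS.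
rewrite (@vproj_indicator _ _ _ _ _ _ (T `&` S')%fset) => [|k kT].
  exact: GP_face.
by rewrite in_fsetI kT.
Qed.
End Compatibility.

Definition GP_hopf : connected_hopf_monoid GP_species.
Proof.
refine (@ConnectedHopfMonoid _ GP_species GP_one GP_mul GP_res GP_con
  GP_fset0 GP_mul_nat _ _ GP_mul1 GP_1mul GP_res_all GP_con_none GP_mulA
  _ _ _ _ _).
- by move=> K L I S T J S' T' d d' s sS sT hs hS hT rS rT z;
    case: (GP_coproduct_nat d d' hs hS hT rS rT z).
- by move=> K L I S T J S' T' d d' s sS sT hs hS hT rS rT z;
    case: (GP_coproduct_nat d d' hs hS hT rS rT z).
- by move=> K I A B C AB BC d1 d2 d3 d4 w; case: (GP_coassoc d1 d2 d3 d4 w).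
- by move=> K I A B C AB BC d1 d2 d3 d4 w; case: (GP_coassoc d1 d2 d3 d4 w).
- by move=> K I A B C AB BC d1 d2 d3 d4 w; case: (GP_coassoc d1 d2 d3 d4 w).
- by move=> K I S T S' T' d d' dS dT dS' dT' x y;
    case: (GP_compat d d' dS dT dS' dT' x y).
- by move=> K I S T S' T' d d' dS dT dS' dT' x y;
    case: (GP_compat d d' dS dT dS' dT' x y).
Defined.
End Operations.

Theorem theorem5p3 (R : realType) :
  exists (M : set_species (@GP R)) (H : connected_hopf_monoid M),
    [/\ (forall (K L : choiceType) (I : {fset K}) (J : {fset L}) (s : I -> J)
           (hs : bijective s) (p : GP R I),
           sval (sp_map M hs p) = relabel s @` sval p),
        (forall (K : choiceType) (I S T : {fset K}) (d : decomp I S T)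
           (p : GP R S) (q : GP R T),
           sval (hm_mul H d p q) = poly_prod d (sval p) (sval q))
      & (forall (K : choiceType) (I S T : {fset K}) (d : decomp I S T)
           (p : GP R I),
           max_face (sval p) (indicator R I S) =
           poly_prod d (sval (hm_res H d p)) (sval (hm_con H d p)))].
Proof.
exists (GP_species R), (GP_hopf R); split => //.
by move=> K I S T d p; exact: GP_face.
Qed.
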